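(* Let $p\ge 2$ be an integer. Each of the following graphs is a cograph minimal obstruction for arboricity $p$: (1) $K_{2p+1}$; (2) $\overline{(p+1)K_{p+1}}$; (3) $2K_{2p-1}\oplus\overline{K_2}$; (4) $2\,\overline{pK_p}\oplus\overline{K_{p+1}}$; (5) $\overline{pK_2}\oplus(K_1+K_p)$; (6) $\left(\overline{pK_p}+K_{2p-1}\right)\oplus\overline{K_2}$; (7) $\overline{(p+1+i)K_2+(p-1-2i)K_1}$ for every integer $i$ with $0\le i\le\lfloor\frac{p-1}{2}\rfloor$.
   Context: All graphs are finite and simple. $G+H$ denotes disjoint union, $nG$ the disjoint union of $n$ copies of $G$ (so $2\,\overline{pK_p}$ is two disjoint copies of $\overline{pK_p}$), $G\oplus H$ the join (the disjoint union plus all edges between $G$ and $H$), and $\overline{G}$ the complement. A cograph is a graph with no induced path $P_4$ on four vertices; equivalently, a graph obtainable from $K_1$ by repeatedly applying disjoint union and complement. A cograph minimal obstruction for arboricity $p$ is a cograph whose vertex set cannot be partitioned into $p$ (possibly empty) subsets each inducing a forest, but such that the vertex set of every proper induced subgraph can be so partitioned. *)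

(* Defs.v *)
From mathcomp Require Import all_boot.

Set Implicit Arguments.
Unset Strict Implicit.
Unset Printing Implicit Defensive.

Record sgraph := SGraph {
  vertex :> finType;
  adj : rel vertex;
  adj_sym : symmetric adj;
  adj_irr : irreflexive adj }.

Declare Scope sgraph_scope.
Delimit Scope sgraph_scope with sg.
Bind Scope sgraph_scope with sgraph.

Section Complete.
Variable n : nat.
Definition complete_adj : rel 'I_n := fun i j => i != j.
Lemma complete_sym : symmetric complete_adj.
Proof. by move=> i j; rewrite /complete_adj eq_sym. Qed.
Lemma complete_irr : irreflexive complete_adj.
Proof. by move=> i; rewrite /complete_adj eqxx. Qed.
Definition complete : sgraph := SGraph complete_sym complete_irr.
End Complete.

(* The path on n vertices, 0 - 1 - ... - n.-1. *)
Section PathGraph.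
Variable n : nat.
Definition path_adj : rel 'I_n := fun i j => (i.+1 == j :> nat) || (j.+1 == i :> nat).
Lemma path_sym : symmetric path_adj.
Proof. by move=> i j; rewrite /path_adj orbC. Qed.
Lemma path_irr : irreflexive path_adj.
Proof. by move=> i; rewrite /path_adj orbb -addn1 -{2}[val i]addn0 eqn_add2l. Qed.
Definition path_graph : sgraph := SGraph path_sym path_irr.
End PathGraph.

Section Compl.
Variable G : sgraph.
Definition compl_adj : rel G := fun x y => (x != y) && ~~ adj x y.
Lemma compl_sym : symmetric compl_adj.
Proof. by move=> x y; rewrite /compl_adj eq_sym adj_sym. Qed.
Lemma compl_irr : irreflexive compl_adj.
Proof. by move=> x; rewrite /compl_adj eqxx. Qed.
Definition compl : sgraph := SGraph compl_sym compl_irr.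
End Compl.

Section UnionJoin.
Variables G H : sgraph.

(* [cross] says whether vertices of different summands are adjacent. *)
Definition sum_adj (cross : bool) : rel (G + H)%type := fun u v =>
  match u, v with
  | inl x, inl y => adj x y
  | inr x, inr y => adj x y
  | _, _ => cross
  end.
Lemma sum_sym cross : symmetric (sum_adj cross).
Proof. by move=> [x|x] [y|y] //=; rewrite adj_sym. Qed.
Lemma sum_irr cross : irreflexive (sum_adj cross).
Proof. by move=> [x|x] /=; rewrite adj_irr. Qed.

Definition disjoint_union : sgraph := SGraph (sum_sym false) (sum_irr false).
Definition join : sgraph := SGraph (sum_sym true) (sum_irr true).
End UnionJoin.

Notation "G + H" := (disjoint_union G H) : sgraph_scope.
Notation "G (+) H" := (join G H) : sgraph_scope.

Section Copies.
Variables (n : nat) (G : sgraph).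
Definition copies_adj : rel ('I_n * G)%type := fun u v =>
  (u.1 == v.1) && adj u.2 v.2.
Lemma copies_sym : symmetric copies_adj.
Proof. by move=> u v; rewrite /copies_adj eq_sym adj_sym. Qed.
Lemma copies_irr : irreflexive copies_adj.
Proof. by move=> u; rewrite /copies_adj adj_irr andbF. Qed.
Definition copies : sgraph := SGraph copies_sym copies_irr.
End Copies.

Section Induced.
Variables (G : sgraph) (S : {set G}).
Definition induced_adj : rel {x : G | x \in S} := fun x y => adj (val x) (val y).
Lemma induced_sym : symmetric induced_adj.
Proof. by move=> x y; rewrite /induced_adj adj_sym. Qed.
Lemma induced_irr : irreflexive induced_adj.
Proof. by move=> x; rewrite /induced_adj adj_irr. Qed.
Definition induced : sgraph := SGraph induced_sym induced_irr.
End Induced.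

Definition has_induced (H G : sgraph) : Prop :=
  exists f : H -> G, injective f /\ forall x y, adj (f x) (f y) = adj x y.

Definition cograph (G : sgraph) : Prop := ~ has_induced (path_graph 4) G.

(* For [ucycle], a single edge traversed back and forth is a cyclic sequence of
   size 2; the cycles of a graph are those of size at least 3. *)
Definition forest (G : sgraph) : Prop :=
  forall c : seq G, ucycle (@adj G) c -> size c <= 2.

(* The parts may be empty, unlike in [partition]. *)
Definition forest_partitionable (p : nat) (G : sgraph) : Prop :=
  exists V : 'I_p -> {set G},
    [/\ \bigcup_(i < p) V i = [set: G],
        forall i j, i != j -> [disjoint V i & V j]
      & forall i, forest (induced (V i))].

Definition cograph_min_obstruction (p : nat) (G : sgraph) : Prop :=
  [/\ cograph G,
      ~ forest_partitionable p G
    & forall S : {set G}, S \proper [set: G] ->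
        forest_partitionable p (induced S)].

(* Main.v *)
(* A forest has no triangle and no 4-cycle, which bounds the size of its
   intersection with cliques, with complete multipartite graphs and with
   complements of matchings; counting vertices over the p colour classes then
   rules out a partition.  For [2 pK_p^c (+) K_(p+1)^c] the count is weighted.
   Conversely, once a vertex x is deleted, star forests suffice: in most cases
   p disjoint independent sets of equal size are chosen away from x and the
   remaining vertices, at most p of them, are distributed as centres.  For the
   joins, K_(2p-1) and the complement of pK_p admit star colourings in which a
   prescribed vertex is alone in its class; that class can absorb the
   independent side of the join. *)
Require Import Defs.
From mathcomp Require Import all_boot.
From mathcomp Require Import zify perm.

Set Implicit Arguments.
Unset Strict Implicit.
Unset Printing Implicit Defensive.

(** * Closure properties of graphs without an induced path on four vertices *)

(** Distinctness need not be required: if [a = c] or [b = d] the conclusion is among the hypotheses,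
    and [a = d] contradicts them. *)
Definition p4free (G : sgraph) := forall a b c d : G,
  adj a b -> adj b c -> adj c d -> ~~ adj a c -> ~~ adj b d -> adj a d.

Lemma cograph_p4free G : p4free G -> cograph G.
Proof.
move=> freeG [f [_ adj_f]].
pose o k (lt_k4 : k < 4) := Ordinal lt_k4.
have := freeG (f (@o 0 isT)) (f (@o 1 isT)) (f (@o 2 isT)) (f (@o 3 isT)).
by rewrite !adj_f => /(_ isT isT isT isT isT).
Qed.

Lemma p4free_complete n : p4free (complete n).
Proof.
move=> a b c d; rewrite /= /complete_adj => ab bc cd.
rewrite !negbK => /eqP ac /eqP bd.
by rewrite -bd.
Qed.

(** The path on four vertices is self-complementary: an induced path [a b c d] of the complement is
    an induced path [c a d b] of [G]. *)
Lemma p4free_compl G : p4free G -> p4free (compl G).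
Proof.
move=> freeG a b c d /=; rewrite /compl_adj.
move=> /andP[ab nab] /andP[bc nbc] /andP[cd ncd].
rewrite !negb_and !negbK => ac bd.
case/orP: ac => [/eqP->|ac]; first by rewrite cd.
case/orP: bd => [/eqP<-|bd]; first by rewrite ab.
have sym := @adj_sym G.
have ad : a != d by apply: contraTneq ac => ->; rewrite sym.
rewrite ad /=; apply/negP => adad.
move: (freeG c a d b); rewrite sym ac adad (sym d) bd ncd (sym a) => /(_ isT isT isT isT).
by rewrite (sym b) nab (sym c) (negbTE nbc) => /(_ isT).
Qed.

Lemma p4free_disjoint_union G H :
  p4free G -> p4free H -> p4free (disjoint_union G H).
Proof.
move=> freeG freeH [a|a] [b|b] [c|c] [d|d] //=; [exact: freeG|exact: freeH].
Qed.

Lemma p4free_join G H : p4free G -> p4free H -> p4free (join G H).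
Proof.
move=> freeG freeH [a|a] [b|b] [c|c] [d|d] //=; [exact: freeG|exact: freeH].
Qed.

Lemma p4free_copies n G : p4free G -> p4free (copies n G).
Proof.
move=> freeG [i a] [j b] [k c] [l d] /=; rewrite /copies_adj /=.
move=> /andP[/eqP-> ab] /andP[/eqP-> bc] /andP[/eqP-> cd].
by rewrite eqxx /=; apply: freeG ab bc cd.
Qed.

(** * Acyclic vertex sets and star colourings *)

(** Phrased with a predicate on [G], so that cycles need not be moved to the subtype underlying
    [induced]. *)
Definition acyclic_on (G : sgraph) (P : pred G) :=
  forall c : seq G, ucycle (@adj G) c -> all P c -> size c <= 2.

Lemma acyclic_onS (G : sgraph) (P Q : pred G) :
  subpred P Q -> acyclic_on Q -> acyclic_on P.
Proof. by move=> sPQ acQ c cyc allP; apply: acQ cyc (sub_all sPQ allP). Qed.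

Lemma ucycle_map_val (G : sgraph) (S : {set G}) (c : seq (induced S)) :
  ucycle (@adj G) (map val c) = ucycle (@adj (induced S)) c.
Proof.
rewrite /ucycle (map_inj_uniq val_inj); congr (is_true (_ && _)).
by case: c => //= u c; rewrite -map_rcons path_map.
Qed.

Lemma forest_induced (G : sgraph) (S : {set G}) :
  forest (induced S) <-> acyclic_on [in S].
Proof.
split=> [forS c cyc /all_sigP[c' def_c]|acS c cyc].
  pose d : seq (induced S) := c'; have {}def_c : c = map val d := def_c.
  by rewrite def_c size_map; apply: forS; rewrite -ucycle_map_val -def_c.
rewrite -(size_map val); apply: acS; first by rewrite ucycle_map_val.
by apply/allP => _ /mapP[u _ ->]; apply: valP.
Qed.

Lemma colouring_of_partition p G : forest_partitionable p G ->
  exists f : G -> 'I_p, forall i, acyclic_on [pred y | f y == i].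
Proof.
case=> V [covV _ forV].
have /fin_all_exists[f Vf] : forall y, exists i, y \in V i.
  move=> y; have: y \in \bigcup_(i < p) V i by rewrite covV inE.
  by case/bigcupP => i _; exists i.
exists f => i; have /forest_induced := forV i.
by apply: acyclic_onS => y /eqP <-; apply: Vf.
Qed.

Lemma partition_of_colouring p (G : sgraph) (S : {set G}) (f : G -> 'I_p) :
    (forall i, acyclic_on [pred y | (y \in S) && (f y == i)]) ->
  forest_partitionable p (induced S).
Proof.
move=> acf; exists (fun i => [set u : induced S | f (val u) == i]); split.
- by apply/setP => u; rewrite inE; apply/bigcupP; exists (f (val u)); rewrite ?inE.
- move=> i j ij; rewrite -setI_eq0; apply/eqP/setP => u; rewrite !inE.
  by apply: contra_neqF ij => /andP[/eqP<- /eqP].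
move=> i; apply/forest_induced => c cyc allc.
rewrite -(size_map val); apply: (acf i); first by rewrite ucycle_map_val.
apply/allP => _ /mapP[u /(allP allc) u_i ->] /=.
by rewrite (valP u); move: u_i; rewrite inE.
Qed.

(* [C] marks the centres of stars, so that every colour class within [P] is a
   star forest. *)
Definition star_colouring p (G : sgraph) (P : pred G) (f : G -> 'I_p)
    (C : pred G) :=
  (forall u v, P u -> P v -> adj u v -> f u = f v -> C u (+) C v) /\
  (forall u v w, P u -> P v -> P w -> adj u v -> adj u w ->
     f u = f v -> f u = f w -> ~~ C u -> v = w).

(** Take consecutive vertices [a b c d] on a monochromatic cycle. One end of the edge [bc] is not a
    centre, yet it has two distinct neighbours of its own colour: [b] and [d] for [c], or [a] and
    [c] for [b]. *)
Lemma acyclic_star_colouring p (G : sgraph) (P : pred G) (f : G -> 'I_p) C i :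
  star_colouring P f C -> acyclic_on [pred y | P y && (f y == i)].
Proof.
move=> [fC1 fC2] [|a [|b [|c s]]] // /andP[cyc uniq_c] /= allP.
(* On a triangle [d] is [a] again; a longer cycle supplies a fourth vertex. *)
have [d [cd bd Pd /eqP fd]]: exists d, [/\ adj c d, b != d, P d & f d == i].
  case: s => [|d s] in cyc uniq_c allP *.
    exists a; move: cyc uniq_c allP => /= /and4P[ab bc ca _].
    rewrite !inE ca /= andbT [b == a]eq_sym => /andP[/norP[-> _] _].
    by move=> /andP[/andP[-> ->] _].
  exists d; move: cyc uniq_c allP => /= /and4P[_ _ -> _].
  rewrite !inE !negb_or => /and3P[_ /and3P[_ -> _] _].
  by move=> /and5P[_ _ _ /andP[-> ->] _].
move: cyc uniq_c allP => /= /and3P[ab bc _].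
rewrite !inE !negb_or => /and3P[/and3P[_ /eqP ac _] _ _].
move=> /and4P[/andP[Pa /eqP fa] /andP[Pb /eqP fb] /andP[Pc /eqP fc] _].
case: (boolP (C b)) => Cb.
  have Cc : ~~ C c by have := fC1 b c Pb Pc bc; rewrite Cb fb fc => /(_ erefl).
  have := fC2 c b d Pc Pb Pd; rewrite adj_sym bc cd fb fc fd Cc.
  by move=> /(_ isT isT erefl erefl isT) ebd; rewrite ebd eqxx in bd.
have := fC2 b a c Pb Pa Pc; rewrite adj_sym ab bc fa fb fc Cb.
by move=> /(_ isT isT erefl erefl isT).
Qed.

Definition no_mono_C3 (G : sgraph) (C : Type) (f : G -> C) := forall a b c : G,
  adj a b -> adj b c -> adj a c -> f a = f b -> f b = f c -> False.

(** Only the diagonals need inequalities, since adjacent vertices are distinct. Chords are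
    permitted. *)
Definition no_mono_C4 (G : sgraph) (C : Type) (f : G -> C) :=
  forall a b c d : G, a != c -> b != d ->
    adj a b -> adj b c -> adj c d -> adj d a ->
    f a = f b -> f b = f c -> f c = f d -> False.

Lemma adj_neq (G : sgraph) (x y : G) : adj x y -> x != y.
Proof. by apply: contraTneq => ->; rewrite adj_irr. Qed.

(** A proper subset misses some vertex [x], so colouring [G] away from [x] handles all proper
    induced subgraphs at once. The values of [f] and [C] at [x] are left free. *)
Lemma min_obstructionI p (G : sgraph) : p4free G ->
    (forall f : G -> 'I_p, no_mono_C3 f -> no_mono_C4 f -> False) ->
    (forall x : G, exists (f : G -> 'I_p) (C : pred G),
       star_colouring (predC1 x) f C) ->
  cograph_min_obstruction p G.
Proof.
move=> freeG nocol crit; split; first exact: cograph_p4free.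
- move=> /colouring_of_partition[f acf]; apply: (nocol f).
    move=> a b c ab bc ac fab fbc; have := acf (f a) [:: a; b; c].
    rewrite /ucycle /= ab bc (adj_sym c) ac !inE (negbTE (adj_neq ab)).
    by rewrite (negbTE (adj_neq ac)) (adj_neq bc) -fbc -fab eqxx => /(_ isT isT).
  move=> a b c d ac bd ab bc cd da fab fbc fcd.
  have := acf (f a) [:: a; b; c; d].
  rewrite /ucycle /= ab bc cd da !inE (negbTE (adj_neq ab)) (negbTE ac).
  rewrite (negbTE bd) (adj_neq cd) (negbTE (adj_neq bc)) [a == d]eq_sym.
  by rewrite (negbTE (adj_neq da)) -fcd -fbc -fab eqxx => /(_ isT isT).
move=> S /properP[_ [x _ xS]]; have [f [C fC]] := crit x.
apply: (@partition_of_colouring _ _ _ f) => i.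
have := @acyclic_star_colouring _ _ _ f C i fC; apply: acyclic_onS => y /= /andP[yS ->].
by rewrite andbT; apply: contraNneq xS => <-.
Qed.

(** Colour [i] gets the independent set [core (i, _)]. Besides [x], at most [p.+1] vertices are left
    over; they receive distinct colours, so each class is an independent set plus at most one
    centre. *)
Lemma star_colouring_cores p (G : sgraph) (T : finType) (x : G)
    (core : 'I_p.+1 * T -> G) :
    injective core -> (forall w, core w != x) ->
    (forall i s t, ~~ adj (core (i, s)) (core (i, t))) ->
    #|G| <= p.+1 * #|T| + p.+2 ->
  exists (f : G -> 'I_p.+1) (C : pred G), star_colouring (predC1 x) f C.
Proof.
move=> core_inj core_x core_indep cardG.
pose K := [set core w | w : 'I_p.+1 * T]; pose L := ~: (x |: K).
have xK : x \notin K.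
  by apply/imsetP => -[w _ /esym/eqP]; rewrite (negbTE (core_x w)).
have cardK : #|K| = p.+1 * #|T| by rewrite card_imset // card_prod card_ord.
have cardL : #|L| <= p.+1.
  have := cardsC (x |: K); rewrite -/L cardsU1 xK cardK.
  move: cardG; lia.
(* On [L] the index is below [p.+1], so [inord] keeps it and is injective there. Only [x] lies
   outside both the cores and [L], and its colour is irrelevant. *)
pose f v := if [pick w | core w == v] is Some w then w.1 else inord (index v (enum L)).
have f_core w : f (core w) = w.1.
  rewrite /f; case: pickP => [w' /eqP/core_inj -> //|/(_ w)].
  by rewrite eqxx.
have f_L : {in L &, injective f}.
  move=> u v; rewrite /f => uL vL.
  have nL w : core w \notin L by rewrite !inE negbK mem_imset // inE orbT.
  case: pickP => [w /eqP def_u|_]; first by rewrite -def_u (negbTE (nL w)) in uL.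
  case: pickP => [w /eqP def_v|_]; first by rewrite -def_v (negbTE (nL w)) in vL.
  have idx z : z \in L -> index z (enum L) < p.+1.
    by move=> zL; apply: leq_trans cardL; rewrite cardE index_mem mem_enum.
  move/(congr1 val); rewrite /= !inordK ?idx // => /(congr1 (nth x (enum L))).
  by rewrite !nth_index ?mem_enum.
have notL u : u != x -> u \notin L -> exists w, u = core w.
  move=> ux; rewrite !inE negbK (negbTE ux) /= => /imsetP[w _ ->]; by exists w.
have adjL u v : u != x -> v != x -> adj u v -> f u = f v -> (u \in L) (+) (v \in L).
  move=> ux vx uv fuv.
  case: (boolP (u \in L)) => uL; case: (boolP (v \in L)) => vL //=.
    by rewrite (f_L _ _ uL vL fuv) adj_irr in uv.
  have [[i s] du] := notL u ux uL; have [[j t] dv] := notL v vx vL.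
  move: fuv uv; rewrite du dv !f_core /= => ->.
  by rewrite (negbTE (core_indep _ _ _)).
exists f, [in L]; split=> [u v ux vx|u v w ux vx wx uv uw fuv fuw uL].
  exact: adjL.
apply: f_L; last by rewrite -fuv.
  by have := adjL u v ux vx uv fuv; rewrite [in X in X (+) _](negbTE uL).
by have := adjL u w ux wx uw fuw; rewrite [in X in X (+) _](negbTE uL).
Qed.

(** * Star colourings with a prescribed singleton class *)

Definition pointed_star_colouring p (G : sgraph) (s : G) (f : G -> 'I_p.+1)
    (C : pred G) :=
  star_colouring predT f C /\ forall u, (f u == ord0) = (u == s).

(** Number the vertices from 0 with [s] first, and use the classes {0}, {1,2}, {3,4} and so on,
    which are the fibres of [uphalf]. The odd vertex of each pair is its centre. *)
Lemma pointed_complete p (s : complete (2 * p.+1 - 1)) :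
  exists f C, @pointed_star_colouring p _ s f C.
Proof.
have n0 : 0 < 2 * p.+1 - 1 by lia.
pose t (u : complete (2 * p.+1 - 1)) : nat := tperm s (Ordinal n0) u.
have t_inj u v : t u = t v -> u = v by move/val_inj/perm_inj.
have ht u : uphalf (t u) < p.+1.
  by have := ltn_ord (tperm s (Ordinal n0) u); rewrite /t; lia.
pose f u : 'I_p.+1 := Ordinal (ht u).
have f_odd u v : u != v -> f u = f v -> odd (t u) (+) odd (t v).
  move=> uv /(congr1 val) /= huv; apply: contraNT uv => oe.
  apply/eqP/t_inj; move: huv oe; lia.
exists f, (fun u => odd (t u)); split; first split.
- by move=> u v _ _; apply: f_odd.
- move=> u v w _ _ _ uv uw fuv fuw nu; apply/eqP/negPn/negP => vw.
  have := f_odd u v uv fuv; have := f_odd u w uw fuw.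
  have := f_odd v w vw; rewrite -fuv -fuw => /(_ erefl).
  by move: nu; case: (odd (t u)) (odd (t v)) (odd (t w)) => [] [] [].
move=> u; rewrite -val_eqE /=; transitivity (t u == 0); first lia.
apply/idP/eqP => [/eqP tu|->]; last by rewrite /t tpermL.
by apply: t_inj; rewrite tu /t tpermL.
Qed.

(** The complete multipartite graph with [m] parts of size [n]; the first coordinate of a vertex is
    its part. *)
Definition multipartite m n := compl (copies m (complete n)).

Lemma multipartite_adjE m n (u v : multipartite m n) : adj u v = (u.1 != v.1).
Proof.
case: u v => [i a] [j b] /=; rewrite /compl_adj /= /copies_adj /= /complete_adj.
by rewrite xpair_eqE; case: (i == j) => //=; case: (a == b).
Qed.

(** The part of [s] is spread over all colours, with [s] coloured [ord0], while each other part gets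
    one nonzero colour of its own. A nonzero class is then a star centred in the part of [s]. *)
Lemma pointed_multipartite p (s : multipartite p.+1 p.+1) :
  exists f C, @pointed_star_colouring p _ s f C.
Proof.
pose f (u : multipartite p.+1 p.+1) : 'I_p.+1 :=
  if u.1 == s.1 then tperm s.2 ord0 u.2 else tperm s.1 ord0 u.1.
have f_adj u v : adj u v -> f u = f v -> (u.1 == s.1) (+) (v.1 == s.1).
  rewrite multipartite_adjE /f => uv.
  case: eqP => us; case: eqP => vs //=; first by rewrite us vs eqxx in uv.
  by move/perm_inj => e; rewrite e eqxx in uv.
exists f, (fun u => u.1 == s.1); split; first split.
- by move=> u v _ _; apply: f_adj.
- move=> u v w _ _ _ uv uw fuv fuw nu.
  have := f_adj u v uv fuv; have := f_adj u w uw fuw.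
  rewrite (negbTE nu) /= => ws vs; move: fuv; rewrite fuw /f ws vs => /perm_inj.
  case: v w ws vs {uv uw fuw} => [i a] [j b] /= /eqP-> /eqP->; by move->.
move=> u; have -> : (u == s) = (u.1 == s.1) && (u.2 == s.2).
  by case: u s {f f_adj} => [i a] [j b].
have tperm_eq0 (x y : 'I_p.+1) : (tperm x ord0 y == ord0) = (y == x).
  by rewrite -[X in _ == X](tpermL x ord0) (inj_eq perm_inj).
by rewrite /f; case: ifP => us; [apply: tperm_eq0|rewrite /= -us; apply: tperm_eq0].
Qed.

(** * Star colourings of unions, copies and joins *)

Lemma star_colouring_union p (G H : sgraph) (f : G -> 'I_p) (g : H -> 'I_p) C D :
    star_colouring predT f C -> star_colouring predT g D ->
  star_colouring predT (fun u : disjoint_union G H =>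
      match u with inl x => f x | inr y => g y end)
    (fun u => match u with inl x => C x | inr y => D y end).
Proof.
move=> [fC1 fC2] [gD1 gD2]; split.
  by move=> [u|u] [v|v] _ _ //=; [apply: fC1|apply: gD1].
move=> [u|u] [v|v] [w|w] _ _ _ //= uv uw e1 e2 nu; congr (_ _).
  exact: fC2 uv uw e1 e2 nu.
exact: gD2 uv uw e1 e2 nu.
Qed.

Lemma star_colouring_copies p n (G : sgraph) (f : G -> 'I_p) C :
    star_colouring predT f C ->
  star_colouring predT (fun u : copies n G => f u.2) (fun u => C u.2).
Proof.
move=> [fC1 fC2]; split=> [[i u] [j v]|[i u] [j v] [k w]] _ _ /=.
  by move=> /andP[_]; apply: fC1.
move=> _ /andP[/eqP /= <- uv] /andP[/eqP /= <- uw] e1 e2 nu.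
by rewrite (fC2 u v w).
Qed.

Lemma indep_adjF n (x y : compl (complete n)) : adj x y = false.
Proof. by rewrite /= /compl_adj /= /complete_adj negbK andNb. Qed.

(** The whole independent side takes colour [ord0]. Away from [r] at most one vertex of [G] has that
    colour, and it becomes the centre. *)
Lemma star_colouring_joinl p n (G : sgraph) (r : G) (f : G -> 'I_p.+1) C :
    star_colouring predT f C ->
    (forall u v, u != r -> v != r -> f u = ord0 -> f v = ord0 -> u = v) ->
  exists (g : join G (compl (complete n)) -> 'I_p.+1) D,
    @star_colouring _ (join G (compl (complete n))) (predC1 (inl r)) g D.
Proof.
move=> [fC1 fC2] f0.
exists (fun u => if u is inl x then f x else ord0).
exists (fun u => if u is inl x then (f x == ord0) || C x else false).
split.
  move=> [u|u] [v|v] //= ur vr uv fuv.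
  - rewrite -fuv; case: eqP => [fu|_]; last exact: fC1.
    by rewrite (f0 u v) ?adj_irr // -fuv in uv.
  - by rewrite fuv eqxx.
  - by rewrite -fuv eqxx.
  - by move: uv (indep_adjF u v) => /= ->.
move=> [u|u] [v|v] [w|w] //= ur vr wr uv uw fuv fuw.
- by move/norP => [_ nu]; congr inl; apply: fC2 uv uw fuv fuw nu.
- by rewrite fuw eqxx.
- by rewrite fuv eqxx.
- by rewrite fuv eqxx.
- by move=> _; congr inl; apply: f0.
- by move: uw (indep_adjF u w) => /= ->.
- by move: uv (indep_adjF u v) => /= ->.
- by move: uv (indep_adjF u v) => /= ->.
Qed.

Lemma ord2_neq (i j k : 'I_2) : i != k -> j != k -> i = j.
Proof.
by case: i j k => [[|[|//]] ?] [[|[|//]] ?] [[|[|//]] ?] //= _ _; apply/val_inj.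
Qed.

(** The roles are reversed: the vertex other than [r] on the right becomes the centre, and the
    independent class [ord0] of [G] supplies the leaves. *)
Lemma star_colouring_joinr p (G : sgraph) (r : compl (complete 2))
    (f : G -> 'I_p.+1) C :
    star_colouring predT f C ->
    (forall u v, f u = ord0 -> f v = ord0 -> ~~ adj u v) ->
  exists (g : join G (compl (complete 2)) -> 'I_p.+1) D,
    @star_colouring _ (join G (compl (complete 2))) (predC1 (inr r)) g D.
Proof.
move=> [fC1 fC2] f0.
exists (fun u => if u is inl x then f x else ord0).
exists (fun u => if u is inl x then (f x != ord0) && C x else true).
split.
  move=> [u|u] [v|v] //= ur vr uv fuv.
  - rewrite -fuv; case: eqP => [fu|_] /=; last exact: fC1.
    by have := f0 u v fu; rewrite -fuv uv => /(_ fu).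
  - by rewrite fuv eqxx.
  - by rewrite -fuv eqxx.
  - by move: uv (indep_adjF u v) => /= ->.
move=> [u|u] [v|v] [w|w] //= ur vr wr uv uw fuv fuw.
- rewrite negb_and negbK => /orP[/eqP fu|nu]; congr inl.
    by have := f0 u v fu; rewrite -fuv uv => /(_ fu).
  by apply: fC2 uv uw fuv fuw nu.
- by have := f0 u v fuw; rewrite -fuv uv => /(_ fuw).
- by have := f0 u w fuv; rewrite -fuw uw => /(_ fuv).
- by move=> _; congr inr; apply: ord2_neq vr wr.
Qed.

(** * Upper bounds on colour classes *)

Definition colour_class p (G : finType) (f : G -> 'I_p) i := [set x | f x == i].

Lemma sum_card_colour_class p (G : finType) (f : G -> 'I_p) :
  \sum_(i < p) #|colour_class f i| = #|G|.
Proof.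
rewrite -sum1_card (partition_big f predT) //=; apply: eq_bigr => i _.
by rewrite sum1_card cardsE.
Qed.

Lemma leq_card_colour_class p (G : finType) (f : G -> 'I_p) k :
  (forall i, #|colour_class f i| <= k) -> #|G| <= p * k.
Proof.
move=> le_k; rewrite -(sum_card_colour_class f) -[p in p * k]card_ord.
by rewrite -sum_nat_const; apply: leq_sum.
Qed.

Lemma no_mono_C3_comp (G H : sgraph) (C : Type) (f : G -> C) (e : H -> G) :
  (forall x y, adj (e x) (e y) = adj x y) -> no_mono_C3 f -> no_mono_C3 (f \o e).
Proof. by move=> adj_e fC3 a b c ab bc ac; apply: fC3; rewrite adj_e. Qed.

Lemma no_mono_C4_comp (G H : sgraph) (C : Type) (f : G -> C) (e : H -> G) :
    injective e -> (forall x y, adj (e x) (e y) = adj x y) ->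
  no_mono_C4 f -> no_mono_C4 (f \o e).
Proof.
move=> inj_e adj_e fC4 a b c d ac bd ab bc cd da.
by apply: fC4; rewrite ?adj_e ?(inj_eq inj_e).
Qed.

Lemma card_colour_class_complete p n (f : complete n -> 'I_p) i :
  no_mono_C3 f -> #|colour_class f i| <= 2.
Proof.
move=> fC3; rewrite leqNgt; apply/negP.
move=> /card_gt2P[a [b [c []]]]; rewrite !inE => -[/eqP fa /eqP fb /eqP fc] [ab bc ca].
by apply: (fC3 a b c) => //; rewrite ?fa ?fb ?fc //= /complete_adj eq_sym.
Qed.

Lemma card_part m n j : #|[set u : multipartite m n | u.1 == j]| <= n.
Proof.
rewrite -[X in _ <= X]card_ord -cardsT.
apply: leq_trans (leq_imset_card (fun k : 'I_n => (j, k) : multipartite m n) _).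
apply/subset_leq_card/subsetP => -[i k]; rewrite inE /= => /eqP->.
by apply: imset_f.
Qed.

Lemma card_indep_multipartite m n (S : {set multipartite m n}) :
  {in S &, forall u v, ~~ adj u v} -> #|S| <= n.
Proof.
move=> indepS; have [->|[u uS]] := set_0Vmem S; first by rewrite cards0.
apply: leq_trans (card_part n u.1); apply/subset_leq_card/subsetP => v vS.
by have := indepS v u vS uS; rewrite multipartite_adjE negbK inE.
Qed.

(** A class containing an edge meets just two parts, for lack of a triangle, and it has a single
    vertex in one of them, for lack of a 4-cycle. An independent class lies within one part. *)
Lemma card_colour_class_multipartite p m n (f : multipartite m n -> 'I_p) i :
  no_mono_C3 f -> no_mono_C4 f -> #|colour_class f i| <= n.+1.
Proof.
move=> fC3 fC4; set S := colour_class f i.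
have fS u : u \in S -> f u = i by rewrite inE => /eqP.
have [indepS|] := boolP [forall u in S, forall v in S, ~~ adj u v].
  apply/leqW/card_indep_multipartite => u v uS vS.
  by have /forall_inP/(_ u uS)/forall_inP/(_ v vS) := indepS.
move=> /forall_inPn[u uS /forall_inPn[v vS]]; rewrite negbK => uv.
have two w : w \in S -> w.1 != u.1 -> w.1 == v.1.
  move=> wS wu; apply/negPn/negP => wv.
  by apply: (fC3 u v w); rewrite ?fS // multipartite_adjE eq_sym.
have star (x y : multipartite m n) : S \subset x |: [set w | w.1 == y.1] -> #|S| <= n.+1.
  move/subset_leq_card/leq_trans; apply; rewrite cardsU1.
  by rewrite -[n.+1]add1n leq_add ?leq_b1 ?card_part.
have [/forall_inP onlyu|] := boolP [forall w in S, (w.1 == u.1) ==> (w == u)].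
  apply: (star u v); apply/subsetP => w wS; rewrite !inE.
  have := onlyu w wS; have := two w wS.
  by case: (w.1 == u.1) => [_ /= ->|/(_ isT) ->] //; rewrite orbT.
move=> /forall_inPn[u' u'S]; rewrite negb_imply => /andP[u'u nu'u].
apply: (star v u); apply/subsetP => w wS; rewrite !inE.
case: (boolP (w.1 == u.1)) => [|wu]; first by rewrite orbT.
rewrite orbF; apply/negPn/negP => wv.
move: uv; rewrite multipartite_adjE => uv.
have wv1 := eqP (two w wS wu).
apply: (fC4 u v u' w); rewrite ?fS // ?multipartite_adjE ?wv1 ?(eqP u'u) 1?eq_sym //;
  by rewrite eq_sym.
Qed.

(* The hypothesis says that, away from [z], the nonadjacent pairs of [G] form a
   matching. *)
Lemma card_colour_class_matching p (G : sgraph) (z : G) (f : G -> 'I_p) i :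
    (forall a b c, a != z -> b != z -> a != b -> ~~ adj a b ->
       c != a -> c != b -> adj c a && adj c b) ->
  no_mono_C3 f -> no_mono_C4 f -> #|colour_class f i| <= 3.
Proof.
move=> match_z fC3 fC4; set S := colour_class f i.
have fS u : u \in S -> f u = i by rewrite inE => /eqP.
rewrite leqNgt; apply/negP => S_gt3.
have : 2 < #|S :\ z| by move: S_gt3; rewrite (cardsD1 z); case: (z \in S) => /=; lia.
(* A nonadjacent pair away from [z] and any two further vertices of [S], possibly [z] itself, form a
   4-cycle. So [S :\ z] is a clique with at least three vertices, which contains a triangle. *)
have clique u v : u \in S :\ z -> v \in S :\ z -> u != v -> adj u v.
  rewrite !(in_setD1 _ S) => /andP[uz uS] /andP[vz vS] uv.
  apply/negPn/negP => nuv.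
  have : 1 < #|S :\ u :\ v|.
    move: S_gt3; rewrite (cardsD1 u) (cardsD1 v (S :\ u)).
    by case: (u \in S); case: (v \in _) => /=; lia.
  case/card_gt1P => w [t []]; rewrite !in_setD1.
  move=> /and3P[wv wu wS] /and3P[tv tu tS] wt.
  have /andP[adj_wu adj_wv] := match_z u v w uz vz uv nuv wu wv.
  have /andP[adj_tu adj_tv] := match_z u v t uz vz uv nuv tu tv.
  by apply: (fC4 u w v t); rewrite ?fS // 1?(adj_sym u) 1?(adj_sym v).
case/card_gt2P => a [b [c [[aS bS cS] [ab bc ca]]]].
have inS u : u \in S :\ z -> f u = i by rewrite in_setD1 => /andP[_ /fS].
by apply: (fC3 a b c); rewrite ?clique ?inS // eq_sym.
Qed.

(** The [p.+1] classes have at most two vertices each and together only one less than the maximum.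
    So exactly one class falls short, and it is a singleton. *)
Lemma tight_colouring_complete p (f : complete (2 * p.+1 - 1) -> 'I_p.+1) i j :
    no_mono_C3 f ->
    #|colour_class f i| <= 1 -> #|colour_class f j| <= 1 ->
  i = j /\ exists a, f a = i.
Proof.
move=> fC3 ci cj.
have le2 k := card_colour_class_complete k fC3.
have := sum_card_colour_class f; rewrite card_ord (bigD1 i) //= => sum_i.
have bound (Q : pred 'I_p.+1) : \sum_(k | Q k) #|colour_class f k| <= #|Q| * 2.
  by rewrite -sum_nat_const; apply: leq_sum.
split.
  apply/eqP/negPn/negP => ij; move: sum_i; rewrite (bigD1 j) 1?eq_sym //= => sum_ij.
  have := bound [pred k | (k != i) && (k != j)].
  have : #|[pred k | (k != i) && (k != j)]| = p.-1.
    have := cardsC [set i; j]; rewrite cards2 ij card_ord => c2.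
    rewrite (_ : #|_| = #|~: [set i; j]|); first lia.
    by apply: eq_card => k; rewrite !inE negb_or.
  (* Positivity makes the truncated [p.-1] equal to the true count [p.+1 - 2]. *)
  have : 0 < p by move: ij (ltn_ord i) (ltn_ord j); rewrite -val_eqE /=; lia.
  move=> p0 ->; move: ci cj sum_ij; rewrite /=; set x := #|colour_class f i|.
  set y := #|colour_class f j|; set X := (\sum_(_ | _) _); lia.
have : 0 < #|colour_class f i|.
  have := bound (predC1 i); rewrite cardC1 card_ord.
  move: sum_i; rewrite /=; set X := \sum_(_ | _) _; lia.
by case/card_gt0P => a; rewrite inE => /eqP; exists a.
Qed.

(** * Obstructions by counting vertices *)

Lemma obstruction_complete p :
  cograph_min_obstruction p.+1 (complete (2 * p.+1).+1).
Proof.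
apply: min_obstructionI; first exact: p4free_complete.
  move=> f fC3 _.
  have := leq_card_colour_class (fun i => card_colour_class_complete i fC3).
  by rewrite card_ord; lia.
move=> x; have le_p : p.+1 <= 2 * p.+1 by lia.
(* The cores are singletons, and [lift x] keeps them away from [x]. *)
apply: (@star_colouring_cores _ _ unit x (fun w => lift x (widen_ord le_p w.1))).
- by move=> [i []] [j []] /lift_inj /(congr1 val) /= /val_inj ->.
- by move=> w; rewrite eq_sym neq_lift.
- by move=> i [] []; rewrite adj_irr.
by rewrite card_ord card_unit; lia.
Qed.

(** Classes have at most [p.+3] vertices, and $(p+2)^2 = (p+1)(p+3) + 1$. After deleting [x], the
    other parts are the cores and the rest of its part provides the centres. *)
Lemma obstruction_multipartite p :
  cograph_min_obstruction p.+1 (compl (copies p.+2 (complete p.+2))).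
Proof.
apply: min_obstructionI; first exact/p4free_compl/p4free_copies/p4free_complete.
  move=> f fC3 fC4.
  have := leq_card_colour_class
    (fun i => @card_colour_class_multipartite _ _ _ f i fC3 fC4).
  by rewrite card_prod !card_ord; lia.
move=> x; apply: (@star_colouring_cores _ (multipartite p.+2 p.+2) 'I_p.+2 x
  (fun w => (lift x.1 w.1, w.2))).
- move=> [i s] [j t] /= e; have /lift_inj -> := congr1 fst e.
  by have /= -> := congr1 snd e.
- move=> w; apply: contra_neq (neq_lift x.1 w.1) => e; exact: esym (congr1 fst e).
- by move=> i s t; rewrite multipartite_adjE eqxx.
by rewrite card_prod !card_ord; lia.
Qed.

Lemma copies_K2_matching n (u v w : copies n (complete 2)) :
  adj u v -> adj u w -> v = w.
Proof.
case: u v w => [i a] [j b] [k c] /= /andP[/eqP /= <- ab] /andP[/eqP /= <- ac].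
congr (_, _); apply/val_inj; move: ab ac; rewrite /complete_adj.
by case: a b c => [[|[|//]] ?] [[|[|//]] ?] [[|[|//]] ?].
Qed.

Lemma compl_matching_adj (H : sgraph) :
    (forall u v w : H, adj u v -> adj u w -> v = w) ->
  forall a b c : compl H, a != b -> ~~ adj a b ->
    c != a -> c != b -> adj c a && adj c b.
Proof.
move=> matchH a b c ab; rewrite /= /compl_adj ab negbK => adj_ab ca cb.
have sym := @adj_sym H; rewrite ca cb; apply/andP; split; apply/negP => adjc.
  by rewrite (matchH a c b) ?eqxx // sym in cb.
by rewrite (matchH b c a) ?eqxx // sym in ca.
Qed.

Lemma copies_K2_fibre n (i : 'I_n) (s t : 'I_2) :
  ~~ @adj (compl (copies n (complete 2))) (i, s) (i, t).
Proof.
rewrite /= /compl_adj /= /copies_adj eqxx /= /complete_adj.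
by rewrite xpair_eqE eqxx andbN.
Qed.

(** Classes have at most three vertices, one too few in total. For the converse the cores are [p.+1]
    nonadjacent pairs avoiding [x]; having more than [p.+1] pairs leaves enough of them when [x]
    lies in one. *)
Lemma obstruction_compl_matching p a b : p.+1 < a -> 2 * a + b = 3 * p.+1 + 1 ->
  cograph_min_obstruction p.+1
    (compl (copies a (complete 2) + copies b (complete 1))).
Proof.
case: a => // a; rewrite ltnS => pa card_ab.
set H := (_ + _)%sg.
have matchH (u v w : H) : adj u v -> adj u w -> v = w.
  case: u v w => [u|[i u]] [v|[j v]] [w|[k w]] //=.
    by move=> uv uw; rewrite (copies_K2_matching uv uw).
  by rewrite /copies_adj /= /complete_adj !ord1 andbF.
have cardH : #|H| = 3 * p.+1 + 1 by rewrite card_sum !card_prod !card_ord; lia.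
apply: min_obstructionI.
- by apply/p4free_compl/p4free_disjoint_union; apply/p4free_copies/p4free_complete.
- move=> f fC3 fC4.
  have match_z (z u v w : compl H) : u != z -> v != z -> u != v -> ~~ adj u v ->
      w != u -> w != v -> adj w u && adj w v.
    by move=> _ _; apply: compl_matching_adj.
  pose z : compl H := inl (ord0, ord0).
  have := leq_card_colour_class
    (fun i => card_colour_class_matching i (@match_z z) fC3 fC4).
  by rewrite [#|_|]cardH; lia.
have card_le : #|H| <= p.+1 * #|'I_2| + p.+2 by rewrite cardH card_ord; lia.
case=> [x|x].
  apply: (@star_colouring_cores _ (compl H) 'I_2 (inl x)
    (fun w => inl (lift x.1 (widen_ord pa w.1), w.2))) => //.
  - move=> [i s] [j t] /= eq_ij; have e := inl_inj eq_ij; have := congr1 fst e.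
    by have /= -> := congr1 snd e; move=> /lift_inj/(congr1 val) /= /val_inj ->.
  - move=> w; apply: contra_neq (neq_lift x.1 (widen_ord pa w.1)).
    by move=> e; apply: esym (congr1 fst (inl_inj e)).
  by move=> i s t; apply: copies_K2_fibre.
apply: (@star_colouring_cores _ (compl H) 'I_2 (inr x)
  (fun w => inl (widen_ord (leqW pa) w.1, w.2))) => //.
- move=> [i s] [j t] /= eq_ij; have e := inl_inj eq_ij.
  have /(congr1 val) /= /val_inj -> := congr1 fst e.
  by have /= -> := congr1 snd e.
by move=> i s t; apply: copies_K2_fibre.
Qed.

Lemma obstruction_cocktail_join p :
  cograph_min_obstruction p.+1
    (compl (copies p.+1 (complete 2)) (+) (complete 1 + complete p.+1))%sg.
Proof.
set G := (_ (+) _)%sg.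
have cardG : #|G| = 3 * p.+1 + 1.
  by rewrite card_sum card_prod card_sum !card_ord; lia.
apply: min_obstructionI.
- apply: p4free_join; first exact/p4free_compl/p4free_copies/p4free_complete.
  by apply: p4free_disjoint_union; apply: p4free_complete.
(* The isolated vertex of $K_1+K_{p+1}$ is the exception [z]: away from it the nonadjacent pairs are
   disjoint. *)
- move=> f fC3 fC4; pose z : G := inr (inl ord0).
  have match_z (a b c : G) : a != z -> b != z -> a != b -> ~~ adj a b ->
      c != a -> c != b -> adj c a && adj c b.
    case: a b => [a|[a|a]] [b|[b|b]] az bz ab //; rewrite ?[a]ord1 ?[b]ord1 // in az bz.
      case: c => [c|c] // nab ca cb; apply: compl_matching_adj => //.
      exact: copies_K2_matching.
    by rewrite /= /complete_adj negbK => /eqP eab; rewrite eab eqxx in ab.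
  have := leq_card_colour_class
    (fun i => card_colour_class_matching i match_z fC3 fC4).
  by rewrite [#|_|]cardG; lia.
have card_le : #|G| <= p.+1 * #|'I_2| + p.+2 by rewrite cardG card_ord; lia.
case=> [[j e]|x]; last first.
  apply: (@star_colouring_cores _ G 'I_2 (inr x) inl) => //.
    exact: inl_inj.
  by move=> i s t; apply: copies_K2_fibre.
(* The pair [j] is broken by the deletion; the vertex of $K_1$ with one vertex of $K_{p+1}$ replaces
   it. *)
pose core (w : 'I_p.+1 * 'I_2) : G := let: (i, t) := w in
  if i == j then (if t == ord0 then inr (inl ord0) else inr (inr i))
  else inl (i, t).
apply: (@star_colouring_cores _ G 'I_2 _ core) => //.
- move=> [i s] [k t] /=.
  case: (altP (i =P j)) => [->|ij]; case: (altP (k =P j)) => [->|kj] //=.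
  + by case: s t => [[|[|//]] ?] [[|[|//]] ?] //= _; congr (_, _); apply/val_inj.
  + by case: (s == ord0).
  + by case: (t == ord0).
  by case=> -> ->.
- move=> [i t] /=; case: (altP (i =P j)) => ij; first by case: (t == ord0).
  by apply: contra_neq ij => -[].
move=> i s t /=; case: (i == j); last exact: copies_K2_fibre.
by case: (s == ord0); case: (t == ord0) => //=; rewrite /complete_adj eqxx.
Qed.

(** * Obstructions that are joins with an independent set *)

Lemma join_no_mono_C3 (G H : sgraph) (C : Type) (f : join G H -> C) u v x :
  no_mono_C3 f -> adj u v -> f (inl u) = f (inr x) -> f (inl v) = f (inr x) ->
  False.
Proof. by move=> fC3 uv fu fv; apply: (fC3 (inl u) (inl v) (inr x)); rewrite ?fu ?fv. Qed.

Lemma join_no_mono_C4 (G H : sgraph) (C : Type) (f : join G H -> C) u v x y :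
    no_mono_C4 f -> u != v -> x != y -> f (inl u) = f (inr x) ->
    f (inl v) = f (inr x) -> f (inr y) = f (inr x) -> False.
Proof.
move=> fC4 uv xy fu fv fy.
by apply: (fC4 (inl u) (inr x) (inl v) (inr y)); rewrite ?fu ?fv ?fy.
Qed.

(** A colour used on the independent side occurs at most once on the clique, else there is a
    triangle. Tightness then makes the two colours equal and places that colour on the clique. *)
Lemma join_tight_colouring p (G : sgraph) (e : complete (2 * p.+1 - 1) -> G)
    (f : join G (compl (complete 2)) -> 'I_p.+1) :
    (forall u v, adj (e u) (e v) = adj u v) -> no_mono_C3 f ->
  f (inr ord0) = f (inr ord_max) /\ exists a, f (inl (e a)) = f (inr ord0).
Proof.
move=> adj_e fC3.
have gC3 : no_mono_C3 (f \o inl \o e).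
  apply: (@no_mono_C3_comp _ _ _ (f \o inl) e adj_e).
  exact: (@no_mono_C3_comp (join G (compl (complete 2))) G _ f inl).
have class_le1 x : #|colour_class (f \o inl \o e) (f (inr x))| <= 1.
  rewrite leqNgt; apply/negP => /card_gt1P[a [b []]]; rewrite !inE => /eqP fa /eqP fb ab.
  by apply: (join_no_mono_C3 fC3 _ fa fb); rewrite adj_e.
have [eq_f [a fa]] := tight_colouring_complete gC3 (class_le1 ord0) (class_le1 ord_max).
by split; last by exists a.
Qed.

(** Each clique must have a vertex in the common colour of the independent side; these two and the
    independent pair form a 4-cycle. *)
Lemma obstruction_two_cliques_join p :
  cograph_min_obstruction p.+1
    (copies 2 (complete (2 * p.+1 - 1)) (+) compl (complete 2))%sg.
Proof.
apply: min_obstructionI.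
- apply: p4free_join; first exact/p4free_copies/p4free_complete.
  exact/p4free_compl/p4free_complete.
- move=> f fC3 fC4.
  pose e (k : 'I_2) u : copies 2 (complete (2 * p.+1 - 1)) := (k, u).
  have adj_e k u v : adj (e k u) (e k v) = adj u v by rewrite /= /copies_adj eqxx.
  have [fI [a fa]] := join_tight_colouring (adj_e ord0) fC3.
  have [_ [b fb]] := join_tight_colouring (adj_e ord_max) fC3.
  by apply: (join_no_mono_C4 fC4 _ _ fa fb (esym fI)).
case=> [[k s]|r].
  (* Both copies are pointed at [s], so deleting [(k, s)] leaves one vertex of colour [ord0]. *)
  have [f [C [fC f0]]] := pointed_complete s.
  apply: star_colouring_joinl (star_colouring_copies 2 fC) _.
  move=> [i u] [j v] /= neu nev /eqP; rewrite f0 => /eqP eu /eqP; rewrite f0 => /eqP ev.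
  move: neu nev; rewrite eu ev !xpair_eqE !eqxx !andbT => ik jk.
  by rewrite (ord2_neq ik jk).
have n0 : 0 < 2 * p.+1 - 1 by lia.
have [f [C [fC f0]]] := pointed_complete (Ordinal n0).
apply: star_colouring_joinr (star_colouring_copies 2 fC) _.
move=> [i u] [j v] /= /eqP; rewrite f0 => /eqP -> /eqP; rewrite f0 => /eqP ->.
by rewrite /copies_adj /= /complete_adj eqxx andbF.
Qed.

(** The clique forces a common colour on the independent pair, and a 4-cycle bars this colour from
    the multipartite graph. Its $(p+1)^2$ vertices are left with [p] classes of size at most [p.+2],
    one vertex too few. *)
Lemma obstruction_multipartite_clique_join p :
  cograph_min_obstruction p.+1
    ((compl (copies p.+1 (complete p.+1)) + complete (2 * p.+1 - 1))
       (+) compl (complete 2))%sg.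
Proof.
have n0 : 0 < 2 * p.+1 - 1 by lia.
set G := (_ (+) _)%sg; apply: min_obstructionI.
- apply: p4free_join; last exact/p4free_compl/p4free_complete.
  apply: p4free_disjoint_union; last exact: p4free_complete.
  exact/p4free_compl/p4free_copies/p4free_complete.
- move=> f fC3 fC4.
  have [//|fI [b fb]] := @join_tight_colouring _ (_ + _)%sg inr f _ fC3.
  set i := f (inr ord0) in fI fb.
  pose e (u : multipartite p.+1 p.+1) : G := inl (inl u).
  have inj_e : injective e by move=> u v [].
  have gC3 := no_mono_C3_comp (e := e) (fun u v => erefl) fC3.
  have gC4 := no_mono_C4_comp inj_e (fun u v => erefl) fC4.
  have no_i u : (f \o e) u != i.
    apply/eqP => fu.
    by apply: (join_no_mono_C4 fC4 _ _ fu fb (esym fI)).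
  have := sum_card_colour_class (f \o e).
  rewrite card_prod !card_ord (bigD1 i) //= (_ : #|_| = 0); last first.
    by apply/eqP; rewrite cards_eq0; apply/eqP/setP => u; rewrite !inE (negbTE (no_i u)).
  have : \sum_(k | k != i) #|colour_class (f \o e) k| <= #|predC1 i| * p.+2.
    rewrite -sum_nat_const; apply: leq_sum => k _.
    exact: card_colour_class_multipartite.
  by rewrite cardC1 card_ord /=; set X := (\sum_(_ | _) _); lia.
case=> [[m|s]|r].
- have [f [C [fC f0]]] := pointed_multipartite m.
  have [g [D [gD g0]]] := pointed_complete (Ordinal n0).
  apply: (@star_colouring_joinl _ 2 (_ + _)%sg (inl m) _ _ (star_colouring_union fC gD)).
  move=> [u|u] [v|v] /= neu nev /eqP;
    rewrite ?f0 ?g0 => /eqP eu /eqP; rewrite ?f0 ?g0 => /eqP ev.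
  + by rewrite eu eqxx in neu.
  + by rewrite eu eqxx in neu.
  + by rewrite ev eqxx in nev.
  by rewrite eu ev.
- have [f [C [fC f0]]] := @pointed_multipartite p (ord0, ord0).
  have [g [D [gD g0]]] := pointed_complete s.
  apply: (@star_colouring_joinl _ 2 (_ + _)%sg (inr s) _ _ (star_colouring_union fC gD)).
  move=> [u|u] [v|v] /= neu nev /eqP;
    rewrite ?f0 ?g0 => /eqP eu /eqP; rewrite ?f0 ?g0 => /eqP ev.
  + by rewrite eu ev.
  + by rewrite ev eqxx in nev.
  + by rewrite eu eqxx in neu.
  by rewrite eu eqxx in neu.
have [g [D [gD g0]]] := pointed_complete (Ordinal n0).
(* Now class [ord0] only has to be independent, so colouring by parts suffices, without any
   centre. *)
have fC : @star_colouring p.+1 (multipartite p.+1 p.+1) predT (fun u => u.1) pred0.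
  split=> [u v _ _|u v w _ _ _]; rewrite multipartite_adjE.
    by move=> /eqP.
  by move=> /eqP uv _ /uv.
apply: (@star_colouring_joinr _ (_ + _)%sg r _ _ (star_colouring_union fC gD)).
move=> [u|u] [v|v] //=.
  by move=> u0 v0; have := multipartite_adjE u v; rewrite u0 v0 eqxx /= => ->.
move=> /eqP; rewrite g0 => /eqP-> /eqP; rewrite g0 => /eqP->.
by rewrite /complete_adj eqxx.
Qed.

Lemma obstruction_two_multipartite_join p :
  cograph_min_obstruction p.+1
    (copies 2 (compl (copies p.+1 (complete p.+1))) (+) compl (complete p.+2))%sg.
Proof.
set G := (_ (+) _)%sg.
apply: min_obstructionI.
- apply: p4free_join; last exact/p4free_compl/p4free_complete.
  exact/p4free_copies/p4free_compl/p4free_copies/p4free_complete.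
- move=> f fC3 fC4.
  pose e k (u : multipartite p.+1 p.+1) : G := inl (k, u).
  have inj_e k : injective (e k) by move=> u v [].
  have adj_e k u v : adj (e k u) (e k v) = adj u v by rewrite /= /copies_adj eqxx.
  have gC3 k := no_mono_C3_comp (adj_e k) fC3.
  have gC4 k := no_mono_C4_comp (inj_e k) (adj_e k) fC4.
  pose I := compl (complete p.+2); pose h (x : I) := f (inr x).
  pose n k c := #|colour_class (f \o e k) c|.
  have n_le k c : n k c <= p.+2 by apply: card_colour_class_multipartite.
  have n_le_indep k c : 0 < #|colour_class h c| -> n k c <= p.+1.
    case/card_gt0P => x; rewrite inE => /eqP hx.
    apply: card_indep_multipartite => u v; rewrite !inE => /eqP fu /eqP fv.
    apply/negP => uv; apply: (@join_no_mono_C3 _ _ _ f (k, u) (k, v) x fC3).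
    + by rewrite /= /copies_adj eqxx.
    + by rewrite -/(h x) hx.
    by rewrite -/(h x) hx.
  (* Two vertices of a class on the independent side and two on the other would form a 4-cycle. *)
  have n_le1 c : 1 < #|colour_class h c| -> n ord0 c + n ord_max c <= 1.
    case/card_gt1P => x [y []]; rewrite !inE => /eqP hx /eqP hy xy.
    have one k l u v : f (e k u) = c -> f (e l v) = c -> (k, u) = (l, v).
      move=> fu fv; apply/eqP/negPn/negP => uv.
      apply: (@join_no_mono_C4 _ _ _ f (k, u) (l, v) x y fC4) => //.
      + by rewrite -/(h x) hx.
      + by rewrite -/(h x) hx.
      by rewrite -/(h x) hx.
    have le1 k : n k c <= 1.
      rewrite leqNgt; apply/negP => /card_gt1P[u [v []]].
      rewrite !inE => /eqP fu /eqP fv.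
      by have [->] := one k k u v fu fv; rewrite eqxx.
    have := le1 ord0; have := le1 ord_max.
    have : n ord0 c = 0 \/ n ord_max c = 0.
      case: (posnP (n ord0 c)) => [|/card_gt0P[u]]; first by left.
      case: (posnP (n ord_max c)) => [|/card_gt0P[v]]; first by right.
      by rewrite !inE => /eqP fv /eqP fu; have := one _ _ _ _ fu fv.
    lia.
  (* The weights are such that classes with no vertex in [I] and classes
     containing all of [I] are both extremal. *)
  have weight c : p.+2 * (n ord0 c + n ord_max c) +
      (2 * p.+1 + 1) * #|colour_class h c| <= p.+2 * (2 * p.+2).
    have := n_le ord0 c; have := n_le ord_max c.
    have := n_le_indep ord0 c; have := n_le_indep ord_max c; have := n_le1 c.
    have : #|colour_class h c| <= p.+2 by rewrite -[X in _ <= X]card_ord max_card.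
    case: #|_| => [|[|k]]; first nia.
      move=> _ _ /(_ isT) n1 /(_ isT) n0 _ _; nia.
    move=> lek /(_ isT) n1 _ _ _ _; nia.
  have sumM k : \sum_c n k c = p.+1 * p.+1.
    by rewrite (sum_card_colour_class (f \o e k)) card_prod !card_ord.
  have sumI : \sum_c #|colour_class h c| = p.+2.
    by rewrite (sum_card_colour_class h) card_ord.
  (* Summed over the colours and divided by [p.+2], the weights would give $2(p+1)^2+2(p+1)+1 \le
     2(p+1)(p+2)$, which fails by one. *)
  have := @leq_sum _ (index_enum 'I_p.+1) predT _ _ (fun c _ => weight c).
  rewrite big_split /= -!big_distrr /= big_split /= !sumM sumI sum_nat_const card_ord.
  nia.
case=> [[k m]|r].
  have [f [C [fC f0]]] := pointed_multipartite m.
  apply: (@star_colouring_joinl _ p.+2 (copies 2 _) (k, m) _ _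
    (star_colouring_copies 2 fC)).
  move=> [i u] [j v] /= neu nev /eqP; rewrite f0 => /eqP eu /eqP; rewrite f0 => /eqP ev.
  move: neu nev; rewrite eu ev !xpair_eqE !eqxx !andbT => ik jk.
  by rewrite (ord2_neq ik jk).
(* Core [i] joins the [i]-th parts of both copies; the [p.+1] remaining vertices of the independent
   side are the centres. *)
apply: (@star_colouring_cores _ G ('I_2 * 'I_p.+1)%type (inr r)
  (fun w => inl (w.2.1, (w.1, w.2.2)))) => //.
- by move=> [i [k s]] [j [l t]] [/= -> -> ->].
- move=> i [k s] [l t]; rewrite /= /copies_adj /= /compl_adj /= /copies_adj /=.
  rewrite eqxx /= /complete_adj xpair_eqE eqxx /= negbK.
  by case: (s == t); rewrite !andbF.
by rewrite card_sum !card_prod !card_ord; lia.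
Qed.

Theorem lemma3 (p : nat) (hp : 2 <= p) :
  cograph_min_obstruction p (complete (2 * p + 1)) /\
  cograph_min_obstruction p (compl (copies (p + 1) (complete (p + 1)))) /\
  cograph_min_obstruction p
    (copies 2 (complete (2 * p - 1)) (+) compl (complete 2))%sg /\
  cograph_min_obstruction p
    (copies 2 (compl (copies p (complete p))) (+) compl (complete (p + 1)))%sg /\
  cograph_min_obstruction p
    (compl (copies p (complete 2)) (+) (complete 1 + complete p))%sg /\
  cograph_min_obstruction p
    ((compl (copies p (complete p)) + complete (2 * p - 1))
       (+) compl (complete 2))%sg /\
  (forall i : nat, i <= (p - 1) %/ 2 ->
     cograph_min_obstruction p
       (compl (copies (p + 1 + i) (complete 2)
               + copies (p - 1 - 2 * i) (complete 1)))).
Proof.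
case: p hp => // p _; rewrite !addn1.
split; first exact: obstruction_complete.
split; first exact: obstruction_multipartite.
split; first exact: obstruction_two_cliques_join.
split; first exact: obstruction_two_multipartite_join.
split; first exact: obstruction_cocktail_join.
split; first exact: obstruction_multipartite_clique_join.
(* This bound makes the truncated subtraction exact, so the vertex count does not depend on [i]. *)
move=> i le_i; have {}le_i : 2 * i <= p by lia.
by apply: obstruction_compl_matching; lia.
Qed.
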